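(* Every locally nilpotent group is an epimorphic image of a pseudo-free locally nilpotent group; that is, for every locally nilpotent group $G$ there are a set $M$, an increasing function $c\colon[M]^{<\aleph_0}\to\omega$ and a surjective group homomorphism $\mathrm{Fr}(M,c)\to G$.
   Context: A group is locally nilpotent if every finitely generated subgroup of it is nilpotent. $[M]^{<\aleph_0}$ denotes the family of all finite subsets of $M$. A function $c\colon [M]^{<\aleph_0}\to\omega$ is increasing if $U\subseteq V$ implies $c(U)\le c(V)$. For a group $G$, the lower central series is indexed by $G^0=G$ and $G^{n+1}=[G^n,G]$. For $U\subseteq M$ let $F_U=\langle x_m\mid m\in U\rangle$ be the free group freely generated by the elements $x_m$ ($m\in U$), regarded as a subgroup of $F=F_M$. The pseudo-free locally nilpotent group is $\mathrm{Fr}(M,c)=F/K$, where $K=K(M,c)$ is the normal subgroup of $F$ generated by $\bigcup_{U\in[M]^{<\aleph_0}} F_U^{c(U)}$, with $F_U^{c(U)}$ the $c(U)$-th term of the lower central series of $F_U$, indexed by $F_U^0=F_U$ and $F_U^{n+1}=[F_U^n,F_U]$. *)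

(* Defs.v *)
From HB Require Import structures.
From mathcomp Require Import all_boot.
From mathcomp Require Import generic_quotient finmap.
From mathcomp Require Import boolp classical_sets cardinality.

Set Implicit Arguments.
Unset Strict Implicit.
Unset Printing Implicit Defensive.

Local Open Scope classical_set_scope.
Local Open Scope quotient_scope.
Local Open Scope group_scope.

Section Subgroups.
Variable G : groupType.
Implicit Types A B H N : set G.

Definition subgroup H :=
  [/\ H 1, forall x y, H x -> H y -> H (x * y) & forall x, H x -> H x^-1].

Definition normal_subgroup N := subgroup N /\ forall x y, N x -> N (x ^ y).

Definition generated A : set G := smallest subgroup A.

Definition normal_closure A : set G := smallest normal_subgroup A.

Definition commutator_subgroup A B : set G :=
  generated [set z | exists x y, [/\ A x, B y & z = [~ x, y]]].

Fixpoint lower_central H (n : nat) : set G :=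
  if n is n'.+1 then commutator_subgroup (lower_central H n') H else H.

Definition nilpotent H := exists n, lower_central H n = [set 1].

Definition finitely_generated H :=
  exists2 A : set G, finite_set A & H = generated A.

Lemma normal_closure_normal A : normal_subgroup (normal_closure A).
Proof.
split; first split.
- by move=> N [[[]]].
- move=> x y Ax Ay N NA; have [[[_ NM _] _] _] := NA.
  by apply: NM; [apply: Ax | apply: Ay].
- by move=> x Ax N NA; have [[[_ _ NV] _] _] := NA; apply: NV; apply: Ax.
- by move=> x y Ax N NA; have [[_ NJ] _] := NA; apply: NJ; apply: Ax.
Qed.

End Subgroups.

Definition locally_nilpotent (G : groupType) :=
  forall H : set G, finitely_generated H -> nilpotent H.

Record normalGroup (G : groupType) := NormalGroup {
  normal_set :> set G;
  normalP : normal_subgroup normal_set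
}.

Section Quotient.
Variables (G : groupType) (N : normalGroup G).
Implicit Types x y : G.

Definition coset_eq : rel G := fun x y => `[< normal_set N (x^-1 * y) >].

Fact coset_eq_refl : reflexive coset_eq.
Proof. by move=> x; apply/asboolP; rewrite mulVg; have [[]] := normalP N. Qed.

Fact coset_eq_sym : symmetric coset_eq.
Proof.
have [[_ _ NV] _] := normalP N.
by move=> x y; apply/asboolP/asboolP => /NV; rewrite invgM invgK.
Qed.

Fact coset_eq_trans : transitive coset_eq.
Proof.
have [[_ NM _] _] := normalP N.
move=> y x z /asboolP xy /asboolP yz; apply/asboolP.
by have := NM _ _ xy yz; rewrite -mulgA mulVKg.
Qed.

Canonical coset_equiv :=
  EquivRel coset_eq coset_eq_refl coset_eq_sym coset_eq_trans.

Definition quotient : Type := {eq_quot coset_equiv}.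

HB.instance Definition _ := Choice.on quotient.
HB.instance Definition _ := EqQuotient.on quotient.

Fact quotient_eqP x y :
  \pi_quotient x = \pi_quotient y <-> normal_set N (x^-1 * y).
Proof. by split=> [/eqmodP/asboolP | Nxy] //; apply/eqmodP/asboolP. Qed.

Definition quotient_one : quotient := \pi_quotient 1.
Definition quotient_mul (a b : quotient) : quotient :=
  \pi_quotient (repr a * repr b).
Definition quotient_inv (a : quotient) : quotient := \pi_quotient (repr a)^-1.

Fact pi_quotientM x y :
  \pi_quotient (x * y) = quotient_mul (\pi_quotient x) (\pi_quotient y).
Proof.
have [[_ NM _] NJ] := normalP N.
have /quotient_eqP := reprK (\pi_quotient x).
have /quotient_eqP := reprK (\pi_quotient y).
rewrite /quotient_mul; set x' := repr (\pi x); set y' := repr (\pi y) => Ny Nx.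
apply/esym/quotient_eqP.
have := NM _ _ (NJ _ y' Nx) Ny.
by rewrite conjgE invgM !mulgA mulgK.
Qed.

Fact pi_quotientV x :
  \pi_quotient x^-1 = quotient_inv (\pi_quotient x).
Proof.
have [[_ _ NV] NJ] := normalP N.
have /quotient_eqP/NV := reprK (\pi_quotient x).
rewrite /quotient_inv; set x' := repr _ => Nx.
apply/esym/quotient_eqP; have := NJ _ x'^-1 Nx.
by rewrite conjgE !invgM !invgK !mulgA mulgK.
Qed.

Fact quotient_mulA : associative quotient_mul.
Proof.
elim/quotW=> x; elim/quotW=> y; elim/quotW=> z.
by rewrite -(pi_quotientM y) -(pi_quotientM x y) -2!pi_quotientM mulgA.
Qed.

Fact quotient_mul1g : left_id quotient_one quotient_mul.
Proof. by elim/quotW=> x; rewrite -pi_quotientM mul1g. Qed.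

Fact quotient_mulg1 : right_id quotient_one quotient_mul.
Proof. by elim/quotW=> x; rewrite -pi_quotientM mulg1. Qed.

Fact quotient_mulVg : left_inverse quotient_one quotient_inv quotient_mul.
Proof. by elim/quotW=> x; rewrite -pi_quotientV -pi_quotientM mulVg. Qed.

Fact quotient_mulgV : right_inverse quotient_one quotient_inv quotient_mul.
Proof. by elim/quotW=> x; rewrite -pi_quotientV -pi_quotientM mulgV. Qed.

HB.instance Definition _ := isGroup.Build quotient quotient_mulA
  quotient_mul1g quotient_mulg1 quotient_mulVg quotient_mulgV.

End Quotient.

(* The free group on M, as the set of reduced words.  The letter (m, true) is
   the generator x_m and (m, false) is its inverse. *)
Section FreeGroup.
Variable M : choiceType.
Implicit Types (a b : M * bool) (u v w : seq (M * bool)).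

Definition letter_inv a : M * bool := (a.1, ~~ a.2).

Definition reduced w := sorted (fun a b => b != letter_inv a) w.

Definition push a w :=
  if w is b :: w' then if b == letter_inv a then w' else a :: w else [:: a].

Definition word_mul u v := foldr push v u.

Definition word_inv w := rev (map letter_inv w).

Fact letter_invK : involutive letter_inv.
Proof. by case=> m b; rewrite /letter_inv /= negbK. Qed.

Fact push_reduced a w : reduced w -> reduced (push a w).
Proof.
case: w => //= b w; case: ifPn => [_|ba] bw; last by rewrite /= ba.
exact: path_sorted bw.
Qed.

Fact pushK a w : reduced w -> push (letter_inv a) (push a w) = w.
Proof.
case: w => [_|b w] /=; first by rewrite letter_invK eqxx.
case: eqP => [-> | _ _]; last by rewrite /= letter_invK eqxx.
by case: w => //= c w /andP[/negPf-> _].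
Qed.

Fact word_mul_reduced u v : reduced v -> reduced (word_mul u v).
Proof. by move=> rv; elim: u => //= a u; apply: push_reduced. Qed.

Fact word_mul_cat u v w : word_mul (u ++ v) w = word_mul u (word_mul v w).
Proof. exact: foldr_cat. Qed.

Fact word_mul_push a u v : reduced v ->
  word_mul (push a u) v = push a (word_mul u v).
Proof.
move=> rv; case: u => //= b u; case: eqP => //= ->.
by rewrite -{1}[a]letter_invK pushK// word_mul_reduced.
Qed.

Fact word_mulA u v w : reduced w ->
  word_mul u (word_mul v w) = word_mul (word_mul u v) w.
Proof. by move=> rw; elim: u => //= a u ->; rewrite word_mul_push. Qed.

Fact word_mul0 w : reduced w -> word_mul w [::] = w.
Proof.
elim: w => //= a w IHw aw; rewrite IHw; last exact: path_sorted aw.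
by case: w aw {IHw} => //= b w /andP[/negPf->].
Qed.

Fact word_inv_reduced w : reduced w -> reduced (word_inv w).
Proof.
rewrite /reduced /word_inv rev_sorted sorted_map; apply: sub_sorted.
by move=> a b /=; rewrite letter_invK eq_sym.
Qed.

Fact word_invK : involutive word_inv.
Proof. by move=> w; rewrite /word_inv map_rev revK (mapK letter_invK). Qed.

Fact word_mulVw w : word_mul (word_inv w) w = [::].
Proof.
elim: w => //= a w IHw; rewrite /word_inv /= rev_cons -cats1 word_mul_cat /=.
by rewrite letter_invK eqxx.
Qed.

Record free_group := FreeGroup {
  word :> seq (M * bool);
  wordP : reduced word
}.

HB.instance Definition _ := [isSub for word].
HB.instance Definition _ := [Choice of free_group by <:].

Implicit Types f g : free_group.

Definition free_one := FreeGroup (isT : reduced [::]).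
Definition free_mul f g := FreeGroup (word_mul_reduced f (wordP g)).
Definition free_inv f := FreeGroup (word_inv_reduced (wordP f)).

Fact free_mulA : associative free_mul.
Proof. by move=> f g h; apply/val_inj/word_mulA/wordP. Qed.

Fact free_mul1g : left_id free_one free_mul.
Proof. by move=> f; apply/val_inj. Qed.

Fact free_mulg1 : right_id free_one free_mul.
Proof. by move=> f; apply/val_inj/word_mul0/wordP. Qed.

Fact free_mulVg : left_inverse free_one free_inv free_mul.
Proof. by move=> f; apply/val_inj/word_mulVw. Qed.

Fact free_mulgV : right_inverse free_one free_inv free_mul.
Proof.
move=> f; apply/val_inj => /=.
by rewrite -[in LHS](word_invK f) word_invK -{1}(word_invK f) word_mulVw.
Qed.

HB.instance Definition _ := isGroup.Build free_group free_mulA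
  free_mul1g free_mulg1 free_mulVg free_mulgV.

Definition free_gen (m : M) : free_group :=
  FreeGroup (isT : reduced [:: (m, true)]).

Definition free_sub (U : {fset M}) : set free_group :=
  generated (free_gen @` [set` U]).

End FreeGroup.

Section PseudoFree.
Variables (M : choiceType) (c : {fset M} -> nat).

Definition increasing := forall U V : {fset M}, (U `<=` V)%fset -> c U <= c V.

Definition pseudo_free_kernel : normalGroup (free_group M) :=
  NormalGroup (normal_closure_normal
    (\bigcup_(U in [set: {fset M}]) lower_central (free_sub U) (c U))).

Definition pseudo_free : groupType := quotient pseudo_free_kernel.

End PseudoFree.

(* Main.v *)
(** Take for [M] the group [G] itself and for [c U] the nilpotency class of the
    subgroup generated by [U]. The evaluation [x_g |-> g] sends the [c U]-th
    term of the lower central series of [F_U] into that of the subgroup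
    generated by [U], which is trivial, so it factors through [Fr(M, c)]. *)
Require Import Defs.
From HB Require Import structures.
From mathcomp Require Import all_boot.
From mathcomp Require Import generic_quotient finmap.
From mathcomp Require Import boolp classical_sets cardinality.

Set Implicit Arguments.
Unset Strict Implicit.
Unset Printing Implicit Defensive.

Local Open Scope classical_set_scope.
Local Open Scope quotient_scope.
Local Open Scope group_scope.

Lemma generated_subgroup (G : groupType) (A : set G) : subgroup (generated A).
Proof.
split.
- by move=> N [[]].
- move=> x y Ax Ay N NA; have [[_ NM _] _] := NA.
  by apply: NM; [apply: Ax | apply: Ay].
- by move=> x Ax N NA; have [[_ _ NV] _] := NA; apply: NV; apply: Ax.
Qed.

Section Morphisms.
Variables (G H : groupType) (f : UMagmaMorphism.type G H).

Lemma preimage_subgroup (B : set H) : subgroup B -> subgroup (f @^-1` B).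
Proof.
move=> [B1 BM BV]; split=> [|x y|x] /=.
- by rewrite gmulf1.
- by rewrite gmulfM; apply: BM.
- by rewrite gmulfV; apply: BV.
Qed.

Lemma preimage_normal (B : set H) :
  normal_subgroup B -> normal_subgroup (f @^-1` B).
Proof.
move=> [sB BJ]; split; first exact: preimage_subgroup.
by move=> x y /= Bx; rewrite gmulfJ; apply: BJ.
Qed.

Lemma generated_morph (A : set G) (B : set H) :
  A `<=` f @^-1` B -> generated A `<=` f @^-1` (generated B).
Proof.
move=> AB; apply: smallest_sub; first exact/preimage_subgroup/generated_subgroup.
by move=> x /AB Bfx N [_]; apply.
Qed.

(** Induction on [n]: a morphism maps commutators to commutators. Asking only for an inclusion lets
    the lemma serve both for evaluation on [F_U] and, with the identity morphism, for
    monotonicity. *)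
Lemma lower_central_morph (A : set G) (B : set H) n :
  A `<=` f @^-1` B -> lower_central A n `<=` f @^-1` (lower_central B n).
Proof.
move=> AB; elim: n => //= n IHn; apply: generated_morph.
move=> _ [x [y [Ax Ay ->]]]; exists (f x), (f y).
by split; [apply: IHn | apply: AB | rewrite gmulfR].
Qed.

End Morphisms.

Lemma lower_central_sub (G : groupType) (A B : set G) n :
  A `<=` B -> lower_central A n `<=` lower_central B n.
Proof. exact: (@lower_central_morph G G idfun). Qed.

Lemma normal_subgroup1 (G : groupType) : normal_subgroup [set 1 : G].
Proof.
split; first split=> //= [x y -> ->|x ->]; first by rewrite mulg1.
  by rewrite invg1.
by move=> x y /= ->; rewrite conj1g.
Qed.

Section FreeLift.
Variables (M : choiceType) (G : groupType) (h : M -> G).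

Definition letter_eval (a : M * bool) : G := if a.2 then h a.1 else (h a.1)^-1.

Definition word_eval (w : seq (M * bool)) : G :=
  foldr (fun a g => letter_eval a * g) 1 w.

(** Inverse letters have inverse values, so a cancellation made by [push] is matched by one in [G].
    As the product of reduced words is an iterated [push], evaluation is then multiplicative. *)
Lemma word_eval_push a w : word_eval (push a w) = letter_eval a * word_eval w.
Proof.
case: w => //= b w; case: eqP => //= ->; rewrite /letter_eval /=.
by case: (a.2) => /=; rewrite ?mulVKg ?mulKg.
Qed.

Definition free_lift (x : free_group M) : G := word_eval x.

Lemma free_liftM : {morph free_lift : x y / x * y}.
Proof.
move=> x y; rewrite /free_lift /=; elim: (word x) => [|a w IHw] /=.
  by rewrite mul1g.
by rewrite word_eval_push IHw mulgA.
Qed.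

HB.instance Definition _ := isMultiplicative.Build _ _ free_lift free_liftM.

Lemma free_lift1 : free_lift 1 = 1.
Proof. by []. Qed.

HB.instance Definition _ :=
  Multiplicative_isUMagmaMorphism.Build _ _ free_lift free_lift1.

Lemma free_lift_gen m : free_lift (free_gen m) = h m.
Proof. exact: mulg1. Qed.

End FreeLift.

Section QuotientLift.
Variables (G H : groupType) (N : normalGroup G) (f : UMagmaMorphism.type G H).

(* The proof argument, absent from the body, is what lets the multiplicative
   instance below be inferred. *)
Definition quotient_lift of normal_set N `<=` f @^-1` [set 1] :=
  fun x : quotient N => f (repr x).

Hypothesis Nf : normal_set N `<=` f @^-1` [set 1].

(** The chosen representative of the class of [x] differs from [x] by an element of [N], which [f]
    kills. *)
Lemma quotient_lift_pi x : quotient_lift Nf (\pi_(quotient N) x) = f x.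
Proof.
have /quotient_eqP/Nf /= := reprK (\pi_(quotient N) x).
rewrite /quotient_lift; set y := repr _ => /=.
by rewrite gmulfM gmulfV -(mulVg (f y)) => /mulgI->.
Qed.

Lemma quotient_liftM : {morph quotient_lift Nf : x y / x * y}.
Proof.
elim/quotW=> x; elim/quotW=> y.
(* The group product of classes is [quotient_mul] up to conversion, so [pi_quotientM] read backwards
   turns it into the class of [x * y]. *)
by rewrite [_ * _](esym (pi_quotientM N x y)) !quotient_lift_pi gmulfM.
Qed.

HB.instance Definition _ :=
  isMultiplicative.Build _ _ (quotient_lift Nf) quotient_liftM.

End QuotientLift.

Section NilpotencyClass.
Variables (G : groupType) (lnG : locally_nilpotent G).
Implicit Types U V : {fset G}.

(** The boolean form allows [ex_minn] to select a least [n]; an inclusion, rather than an equality,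
    passes directly to smaller subgroups. *)
Lemma generated_fset_nilpotent U :
  exists n, `[< lower_central (generated [set` U]) n `<=` [set 1] >].
Proof.
have [|n Un] := lnG (H := generated [set` U]); first by exists [set` U].
by exists n; apply/asboolP; rewrite Un.
Qed.

(** The least bound is taken because an arbitrary choice for each [U] could fail to be
    increasing. *)
Definition fset_class U := ex_minn (generated_fset_nilpotent U).

Lemma fset_class_lower_central U :
  lower_central (generated [set` U]) (fset_class U) `<=` [set 1].
Proof. by rewrite /fset_class; case: ex_minnP => n /asboolP. Qed.

(** The lower central terms for [U] lie in those for [V], so the class of [V] is also a bound for
    [U], and minimality concludes. *)
Lemma fset_class_increasing : increasing fset_class.
Proof.
move=> U V /fsubsetP UV; rewrite {1}/fset_class; case: ex_minnP => n _; apply.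
apply/asboolP; apply: subset_trans (@fset_class_lower_central V).
apply: lower_central_sub; apply: sub_smallest2r => //.
exact: generated_subgroup.
Qed.

(** The elements evaluating to 1 form a normal subgroup, so it is enough to treat the terms that
    generate the kernel. *)
Lemma pseudo_free_kernel_sub :
  normal_set (pseudo_free_kernel fset_class) `<=` free_lift id @^-1` [set 1].
Proof.
apply: smallest_sub; first exact/preimage_normal/normal_subgroup1.
move=> x [U _ /(@lower_central_morph _ _ (free_lift id) _ (generated [set` U]))].
move=> Ux; apply: fset_class_lower_central; apply: Ux; apply: generated_morph.
by move=> _ [m Um <-] /=; rewrite free_lift_gen.
Qed.

End NilpotencyClass.

Theorem proposition2p6 (G : groupType) :
  locally_nilpotent G ->
  exists (M : choiceType) (c : {fset M} -> nat),
    increasing c /\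
    exists f : {multiplicative pseudo_free c -> G},
      forall g : G, exists x : pseudo_free c, f x = g.
Proof.
move=> lnG; exists G, (fset_class lnG); split.
  exact: fset_class_increasing.
exists (quotient_lift (@pseudo_free_kernel_sub G lnG)) => g.
(* Surjectivity: the generator indexed by [g] evaluates to [g] itself. *)
exists (\pi_(quotient _) (free_gen g)).
by rewrite -[RHS](free_lift_gen id); apply: quotient_lift_pi.
Qed.
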